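(* Let $f_{\alpha_1}, f_{\alpha_2}$ be continuous probability density functions on $\mathbb{R}$ that are computable continuous and computable in $\mathcal{L}^1(\mathbb{R})$, such that both integrals $\int_{-\infty}^{\infty}\log(1+P\alpha^2/\sigma_1^2)f_{\alpha_1}(\alpha)\,d\alpha$ and $\int_{-\infty}^{\infty}\log(1+P\alpha^2/\sigma_2^2)f_{\alpha_2}(\alpha)\,d\alpha$ are finite. Let $P\in\mathbb{R}_c$ with $P>0$ and $\sigma_1^2,\sigma_2^2\in\mathbb{R}_c$ with $\sigma_1^2>0$, $\sigma_2^2>0$ be arbitrary. Then $$C_S(P,f_{\alpha_1},f_{\alpha_2},\sigma_1^2,\sigma_2^2)\in\underline{\Delta}_2.$$
   Context: $\log$ denotes the logarithm to base $2$. The secrecy capacity is $$C_S(P,f_{\alpha_1},f_{\alpha_2},\sigma_1^2,\sigma_2^2)=\int_{-\infty}^{\infty}\log\Big(1+\frac{P\alpha^2}{\sigma_1^2}\Big)f_{\alpha_1}(\alpha)\,d\alpha-\int_{-\infty}^{\infty}\log\Big(1+\frac{P\alpha^2}{\sigma_2^2}\Big)f_{\alpha_2}(\alpha)\,d\alpha.$$ A real $x$ is computable ($x\in\mathbb{R}_c$) if there is a computable sequence of rationals $(r_n)$ (i.e. $r_n=(-1)^{s(n)}a(n)/b(n)$ with recursive $a,b,s$, $b(n)\ne 0$) with $|x-r_n|<2^{-n}$ for all $n$. $\Sigma_1$ is the set of reals that are limits of a monotonically nondecreasing computable sequence of rationals. $\underline{\Delta}_2$ is the set of reals $x$ for which there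 exist $a,b\in\Sigma_1$ with $x=a-b$. A function $f$ is computable continuous if it maps computable sequences of reals to computable sequences of reals and is effectively uniformly continuous (there is a recursive $d$ with $|x-y|\le1/d(N)\Rightarrow|f(x)-f(y)|\le2^{-N}$). A function $f\in\mathcal{L}^1(\mathbb{R})$ is computable in $\mathcal{L}^1(\mathbb{R})$ if there exist a computable sequence $(f_n)$ of computable functions in $\mathcal{L}^1(\mathbb{R})$ and a recursive $e\colon\mathbb{N}\to\mathbb{N}$ with $\|f-f_n\|_1\le2^{-M}$ for all $n\ge e(M)$. *)

(* Defs.v *)
From HB Require Import structures.
From mathcomp Require Import all_boot all_order all_algebra.
From mathcomp Require Import all_classical all_reals all_analysis.
From mathcomp Require Import Rstruct Rstruct_topology.


Set Implicit Arguments.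
Unset Strict Implicit.
Unset Printing Implicit Defensive.
Import Order.TTheory GRing.Theory Num.Theory.
Import numFieldNormedType.Exports.
Local Open Scope classical_set_scope.
Local Open Scope ring_scope.

Notation RR := Rdefinitions.R.

Inductive rcode : Type :=
| RZero : rcode
| RSucc : rcode
| RProj : nat -> rcode
| RComp : rcode -> list rcode -> rcode
| RPrim : rcode -> rcode -> rcode
| RMu   : rcode -> rcode.

Inductive reval : rcode -> list nat -> nat -> Prop :=
| ev_zero v : reval RZero v 0
| ev_succ x v : reval RSucc (x :: v) x.+1
| ev_proj i v : (i < size v)%N -> reval (RProj i) v (nth 0%N v i)
| ev_comp f gs v ys z :
    revals gs v ys -> reval f ys z -> reval (RComp f gs) v z
| ev_prim0 f g v y : reval f v y -> reval (RPrim f g) (0%N :: v) y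
| ev_primS f g n v y z :
    reval (RPrim f g) (n :: v) y -> reval g (n :: y :: v) z ->
    reval (RPrim f g) (n.+1 :: v) z
| ev_mu f v n :
    reval f (n :: v) 0 ->
    (forall m, (m < n)%N -> exists k, reval f (m :: v) k.+1) ->
    reval (RMu f) v n
with revals : list rcode -> list nat -> list nat -> Prop :=
| evs_nil v : revals nil v nil
| evs_cons g gs v y ys : reval g v y -> revals gs v ys -> revals (g :: gs) v (y :: ys).

Definition recursive1 (a : nat -> nat) : Prop :=
  exists c, forall n, reval c [:: n] (a n).
Definition recursive2 (a : nat -> nat -> nat) : Prop :=
  exists c, forall n k, reval c [:: n; k] (a n k).
Definition recursive3 (a : nat -> nat -> nat -> nat) : Prop :=
  exists c, forall n k m, reval c [:: n; k; m] (a n k m).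

Definition ratseq1 (r : nat -> RR) : Prop :=
  exists a b s, [/\ recursive1 a, recursive1 b, recursive1 s &
    forall n, b n <> 0%N /\
      r n = (-1) ^+ (s n) * (a n)%:R / (b n)%:R].

Definition ratseq2 (r : nat -> nat -> RR) : Prop :=
  exists a b s, [/\ recursive2 a, recursive2 b, recursive2 s &
    forall n k, b n k <> 0%N /\
      r n k = (-1) ^+ (s n k) * (a n k)%:R / (b n k)%:R].

Definition ratseq3 (r : nat -> nat -> nat -> RR) : Prop :=
  exists a b s, [/\ recursive3 a, recursive3 b, recursive3 s &
    forall n k m, b n k m <> 0%N /\
      r n k m = (-1) ^+ (s n k m) * (a n k m)%:R / (b n k m)%:R].

Definition computable_real (x : RR) : Prop :=
  exists r, ratseq1 r /\ forall n, `|x - r n| < 2 ^- n.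

Definition computable_seq (x : nat -> RR) : Prop :=
  exists r, ratseq2 r /\ forall n k, `|x n - r n k| < 2 ^- k.

Definition computable_seq2 (x : nat -> nat -> RR) : Prop :=
  exists r, ratseq3 r /\ forall n m k, `|x n m - r n m k| < 2 ^- k.

Definition Sigma1 (x : RR) : Prop :=
  exists r, [/\ ratseq1 r, (forall n, r n <= r n.+1) & r @ \oo --> x].

Definition Delta2 (x : RR) : Prop :=
  exists a b, [/\ Sigma1 a, Sigma1 b & x = a - b].

Definition computable_continuous (f : RR -> RR) : Prop :=
  (forall x : nat -> RR, computable_seq x -> computable_seq (fun n => f (x n))) /\
  exists d : nat -> nat, [/\ recursive1 d, (forall N, (0 < d N)%N) &
    forall N x y, `|x - y| <= (d N)%:R^-1 -> `|f x - f y| <= 2 ^- N].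

Definition computable_fun_seq (f : nat -> RR -> RR) : Prop :=
  (forall x : nat -> RR, computable_seq x ->
     computable_seq2 (fun n k => f n (x k))) /\
  exists d : nat -> nat -> nat, [/\ recursive2 d, (forall n N, (0 < d n N)%N) &
    forall n N x y, `|x - y| <= (d n N)%:R^-1 -> `|f n x - f n y| <= 2 ^- N].

Definition integral_R (g : RR -> RR) : \bar RR :=
  (\int[@lebesgue_measure RR]_x (g x)%:E)%E.

Definition in_L1 (g : RR -> RR) : Prop :=
  (@lebesgue_measure RR).-integrable setT (fun x => (g x)%:E).

Definition computable_L1 (f : RR -> RR) : Prop :=
  in_L1 f /\
  exists (fs : nat -> RR -> RR) (e : nat -> nat),
    [/\ computable_fun_seq fs, (forall n, in_L1 (fs n)), recursive1 e &
      forall M n, (e M <= n)%N ->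
        (integral_R (fun x => `|f x - fs n x|)%R <= (2 ^- M)%:E)%E].

Definition pdf (f : RR -> RR) : Prop :=
  (forall x, 0 <= f x) /\ integral_R f = 1%E.

Definition log2 (x : RR) : RR := ln x / ln 2.

Definition rate_integrand (P s2 : RR) (f : RR -> RR) (a : RR) : RR :=
  log2 (1 + P * a ^+ 2 / s2) * f a.

(* secrecy capacity C_S(P, f1, f2, s1^2, s2^2); the integrals are real
   numbers under the finiteness hypotheses of the theorem *)
Definition CS (P : RR) (f1 f2 : RR -> RR) (s1 s2 : RR) : RR :=
  fine (integral_R (rate_integrand P s1 f1)) -
  fine (integral_R (rate_integrand P s2 f2)).

(* Main.v *)
(* Both integrals are limits of nondecreasing computable sequences of rationals.
   Split the integral at 0 and reflect, so that it suffices to treat [0, oo),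
   where log2 (1 + P x^2 / s) is nondecreasing.  On a cell [j/D, (j+1)/D) the
   integrand is then at least q g, where q is a rational lower approximation of
   log2 (1 + P x^2 / s) at x = j/D (obtained by comparing integer powers) and g
   is a rational lower approximation of f at j/D, decreased by the oscillation
   that the effective modulus of continuity allows.  The resulting step functions
   are dominated by the integrand and converge to it pointwise, so their
   integrals, which are computable rationals, stay below the integral and
   converge to it; their running maxima are the required sequence. *)
Require Import Defs.
From HB Require Import structures.
From mathcomp Require Import all_boot all_order all_algebra.
From mathcomp Require Import all_classical all_reals all_analysis.
From mathcomp Require Import Rstruct Rstruct_topology.
From mathcomp Require Import measurable_realfun.
From mathcomp Require Import ring lra zify.
Set Implicit Arguments.
Unset Strict Implicit.
Unset Printing Implicit Defensive.
Import Order.TTheory GRing.Theory Num.Theory.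
Import numFieldNormedType.Exports.
Local Open Scope classical_set_scope.
Local Open Scope ring_scope.

(** * Recursive functions of lists *)

(* [f] is only constrained on lists of length [k], the arity. *)
Definition recf k (f : seq nat -> nat) : Prop :=
  exists c, forall v, size v = k -> reval c v (f v).

Lemma eq_recf k f g :
  (forall v, size v = k -> f v = g v) -> recf k f -> recf k g.
Proof. by move=> fg [c hc]; exists c => v sv; rewrite -fg //; exact: hc. Qed.

Lemma recf_nth k i : (i < k)%N -> recf k (fun v => nth 0%N v i).
Proof. by move=> ik; exists (RProj i) => v sv; apply: ev_proj; rewrite sv. Qed.

Lemma recf_succ k f : recf k f -> recf k (fun v => (f v).+1).
Proof.
move=> [c hc]; exists (RComp RSucc [:: c]) => v sv.
by apply: ev_comp (ev_succ _ _); apply: evs_cons (evs_nil _); exact: hc.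
Qed.

Lemma recf_const k n : recf k (fun=> n).
Proof.
elim: n => [|n]; first by exists (RComp RZero [::]) => v _;
  apply: ev_comp (ev_zero _); exact: evs_nil.
exact: recf_succ.
Qed.

(** These projections forward the arguments from position [n] on unchanged; [RComp] needs them to
    drop arguments or to prepend a computed one. *)
Lemma revals_projs (v : seq nat) n :
  (n <= size v)%N -> revals [seq RProj i | i <- iota n (size v - n)] v (drop n v).
Proof.
move eqm : (size v - n)%N => m; elim: m n eqm => [|m ih] n eqm nv.
  by rewrite drop_oversize; [exact: evs_nil | lia].
have nv' : (n < size v)%N by lia.
rewrite (drop_nth 0%N nv') /=; apply: evs_cons; first exact: ev_proj.
by apply: ih => //; lia.
Qed.

Lemma recf_drop k n f : recf k f -> recf (n + k) (fun v => f (drop n v)).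
Proof.
move=> [c hc]; exists (RComp c [seq RProj i | i <- iota n k]) => v sv.
have -> : k = (size v - n)%N by lia.
apply: ev_comp; last by apply: hc; rewrite size_drop; lia.
by apply: revals_projs; lia.
Qed.


(** A recursion step receives the counter, the previous value and then the parameters. This calls
    [f] on a newly computed head followed by the parameters alone. *)
Lemma recf_cons k m f h : recf k.+1 f -> recf (m + k) h ->
  recf (m + k) (fun v => f (h v :: drop m v)).
Proof.
move=> [c hc] [d hd].
exists (RComp c (d :: [seq RProj i | i <- iota m k])) => v sv.
have -> : k = (size v - m)%N by lia.
apply: ev_comp; last by apply: hc; rewrite /= size_drop; lia.
by apply: evs_cons; [exact: hd | apply: revals_projs; lia].
Qed.

Lemma recf_app1 a k f : recursive1 a -> recf k f -> recf k (fun v => a (f v)).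
Proof.
move=> [c hc] [d hd]; exists (RComp c [:: d]) => v sv.
by apply: ev_comp (hc _); apply: evs_cons (evs_nil _); exact: hd.
Qed.

Lemma recf_app2 a k f g : recursive2 a -> recf k f -> recf k g ->
  recf k (fun v => a (f v) (g v)).
Proof.
move=> [c hc] [d hd] [e he]; exists (RComp c [:: d; e]) => v sv.
apply: ev_comp (hc _ _); apply: evs_cons; first exact: hd.
by apply: evs_cons (evs_nil _); exact: he.
Qed.

Lemma recf_recursive1 f : recf 1 f -> recursive1 (fun n => f [:: n]).
Proof. by move=> [c hc]; exists c => n; exact: hc. Qed.

Lemma recf_recursive2 f : recf 2 f -> recursive2 (fun n m => f [:: n; m]).
Proof. by move=> [c hc]; exists c => n m; exact: hc. Qed.

(** [RPrim] recurses on the head of its argument list, so the code prepends [h v] to a copy of [v].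
    As [F] is any function obeying the recursion equations, each use only has to check those two
    equations. *)
Lemma recf_rec k (F : nat -> seq nat -> nat) f g h :
  recf k f -> recf k.+2 g -> recf k h ->
  (forall v, size v = k -> F 0%N v = f v) ->
  (forall n v, size v = k -> F n.+1 v = g [:: n, F n v & v]) ->
  recf k (fun v => F (h v) v).
Proof.
move=> [cf hf] [cg hg] [ch hh] F0 FS.
exists (RComp (RPrim cf cg) (ch :: [seq RProj i | i <- iota 0 k])) => v sv.
apply: (ev_comp (ys := h v :: v)).
  apply: evs_cons; first exact: hh.
  by have := @revals_projs v 0%N isT; rewrite subn0 sv drop0.
elim: (h v) => [|n ih]; first by apply: ev_prim0; rewrite F0 //; exact: hf.
by apply: ev_primS; first exact: ih; rewrite FS//; apply: hg; rewrite /= sv.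
Qed.

(** [RMu] stops at the first zero, and [~~ p] read as a number is 0 exactly when [p] holds. Since
    [m] is given as the least solution, the search terminates. *)
Lemma recf_mu k (p : nat -> seq nat -> bool) m :
  recf k.+1 (fun w => ~~ p (nth 0%N w 0) (behead w)) ->
  (forall v, size v = k -> p (m v) v) ->
  (forall v i, size v = k -> (i < m v)%N -> ~~ p i v) ->
  recf k m.
Proof.
move=> [c hc] pm pN; exists (RMu c) => v sv; apply: ev_mu.
  by have := hc (m v :: v); rewrite /= pm//; apply; rewrite /= sv.
move=> i im; exists 0%N; have := hc (i :: v); rewrite /= (pN _ _ sv im); apply.
by rewrite /= sv.
Qed.

(** * Arithmetic and Boolean closure of recursive functions *)

Lemma recf_tail2 k f : recf k f -> recf k.+2 (fun w => f (drop 2 w)).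
Proof. exact: (@recf_drop k 2). Qed.

Lemma recf_addn k f g : recf k f -> recf k g -> recf k (fun v => f v + g v)%N.
Proof.
move=> hf hg; apply: (recf_rec (F := (fun n v => n + g v)%N) hg _ hf) => [|//|n v _].
  exact: recf_succ (recf_nth (isT : 1 < k.+2)%N).
by rewrite addSn.
Qed.

Lemma recf_muln k f g : recf k f -> recf k g -> recf k (fun v => f v * g v)%N.
Proof.
move=> hf hg; apply: (recf_rec (F := (fun n v => n * g v)%N) _ _ hf).
- exact: (recf_const k 0).
- exact: recf_addn (recf_nth (isT : 1 < k.+2)%N) (recf_tail2 hg).
- by move=> v _; rewrite mul0n.
- by move=> n v _ /=; rewrite drop0 mulSn addnC.
Qed.

Lemma recf_expn k f g : recf k f -> recf k g -> recf k (fun v => f v ^ g v)%N.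
Proof.
move=> hf hg; apply: (recf_rec (F := (fun n v => f v ^ n)%N) _ _ hg).
- exact: (recf_const k 1).
- exact: recf_muln (recf_tail2 hf) (recf_nth (isT : 1 < k.+2)%N).
- by move=> v _; rewrite expn0.
- by move=> n v _ /=; rewrite drop0 expnS.
Qed.

Lemma recf_pred k f : recf k f -> recf k (fun v => (f v).-1).
Proof.
move=> hf; apply: (recf_rec (F := (fun n _ => n.-1)%N) _ _ hf).
- exact: (recf_const k 0).
- exact: recf_nth (isT : 0 < k.+2)%N.
- by [].
- by [].
Qed.

Lemma recf_subn k f g : recf k f -> recf k g -> recf k (fun v => f v - g v)%N.
Proof.
move=> hf hg; apply: (recf_rec (F := (fun n v => f v - n)%N) hf _ hg).
- exact: recf_pred (recf_nth (isT : 1 < k.+2)%N).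
- by move=> v _; rewrite subn0.
- by move=> n v _ /=; rewrite subnS.
Qed.

Lemma recf_leq k f g : recf k f -> recf k g -> recf k (fun v => (f v <= g v)%N : nat).
Proof.
move=> hf hg; apply: eq_recf (recf_subn (recf_const k 1) (recf_subn hf hg)) => v _.
lia.
Qed.

Lemma recf_negb k (p : seq nat -> bool) :
  recf k (fun v => p v : nat) -> recf k (fun v => ~~ p v : nat).
Proof.
move=> hp; apply: eq_recf (recf_subn (recf_const k 1) hp) => v _.
by case: (p v).
Qed.

Lemma recf_odd k f : recf k f -> recf k (fun v => odd (f v) : nat).
Proof.
move=> hf; apply: (recf_rec (F := (fun n v => odd n)%N) _ _ hf).
- exact: (recf_const k 0).
- exact: recf_subn (recf_const _ 1) (recf_nth (isT : 1 < k.+2)%N).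
- by [].
- by move=> n v _ /=; case: (odd n).
Qed.

Lemma recf_if k (p : seq nat -> bool) f g :
  recf k (fun v => p v : nat) -> recf k f -> recf k g ->
  recf k (fun v => if p v then f v else g v).
Proof.
move=> hp hf hg.
have := recf_addn (recf_muln hp hf) (recf_muln (recf_negb hp) hg).
by apply: eq_recf => v _; case: (p v) => /=; lia.
Qed.

(* The pair (i, j) is coded by (i + j)^2 + i, whose integer square root is
   i + j. *)
Lemma recf_unpairing : exists u w : nat -> nat,
  [/\ recursive1 u, recursive1 w & exists p, recursive2 p /\
    forall i j, u (p i j) = i /\ w (p i j) = j].
Proof.
pose r n := Nat.sqrt n.
have rP n : (r n ^ 2 <= n < (r n).+1 ^ 2)%N.
  have := PeanoNat.Nat.sqrt_spec n (le_0_n n); rewrite -/(r n); lia.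
have hr : recf 1 (fun v => r (nth 0%N v 0)).
  (* The integer square root of n is the least t with n < (t + 1)^2. *)
  apply: (recf_mu (p := (fun t v => (nth 0%N v 0).+1 <= t.+1 ^ 2)%N)).
  - apply: recf_negb; apply: recf_leq.
      apply: recf_succ; apply: eq_recf (recf_nth (isT : 1 < 2)%N) => v _.
      by rewrite nth_behead.
    by apply: recf_expn (recf_const _ 2); exact: recf_succ (recf_nth _).
  - by move=> v _; case/andP: (rP (nth 0%N v 0)).
  - move=> v i _ ir; have /andP[+ _] := rP (nth 0%N v 0); nia.
pose u n := (n - r n ^ 2)%N; pose w n := (r n - u n)%N.
have hu : recf 1 (fun v => u (nth 0%N v 0)).
  exact: recf_subn (recf_nth _) (recf_expn hr (recf_const _ 2)).
exists u, w; split.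
- exact: recf_recursive1 hu.
- exact: recf_recursive1 (recf_subn hr hu).
exists (fun i j => (i + j) ^ 2 + i)%N; split.
  apply: (recf_recursive2 (f := fun v => (nth 0 v 0 + nth 0 v 1) ^ 2 + nth 0 v 0)%N).
  by apply: recf_addn; [apply: recf_expn (recf_const _ 2); apply: recf_addn|];
    exact: recf_nth.
(* As i <= i + j, the code stays below (i + j + 1)^2. *)
move=> i j; have e : r ((i + j) ^ 2 + i)%N = (i + j)%N.
  have := rP ((i + j) ^ 2 + i)%N; nia.
by rewrite /w /u e; lia.
Qed.


Lemma recf_prod k b h : recf k.+1 b -> recf k h ->
  recf k (fun v => (\prod_(i < h v) b ((i : nat) :: v))%N).
Proof.
move=> hb hh.
apply: (recf_rec (F := fun n v => (\prod_(i < n) b ((i : nat) :: v))%N) _ _ hh).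
- exact: (recf_const k 1).
- apply: recf_muln (recf_nth (isT : 1 < k.+2)%N) _.
  exact: (@recf_cons k 2 b _ hb (recf_nth (isT : 0 < k.+2)%N)).
- by move=> v _; rewrite big_ord0.
- by move=> n v _ /=; rewrite drop0 big_ord_recr.
Qed.

(** * Nonnegative rational functions and lower semicomputable reals *)

(** Fractions of natural numbers, hence nonnegative; differences are therefore truncated at 0. *)
Definition ratf k (r : seq nat -> RR) : Prop :=
  exists a b, [/\ recf k a, recf k b & forall v, size v = k ->
    (0 < b v)%N /\ r v = (a v)%:R / (b v)%:R].

Lemma eq_ratf k r t :
  (forall v, size v = k -> r v = t v) -> ratf k r -> ratf k t.
Proof.
move=> rt [a [b [ha hb hr]]]; exists a, b; split=> // v sv.
by rewrite -rt//; exact: hr.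
Qed.

Lemma ratf_nat k f : recf k f -> ratf k (fun v => (f v)%:R).
Proof.
move=> hf; exists f, (fun=> 1%N); split=> //; first exact: recf_const.
by move=> v _; rewrite divr1.
Qed.

Lemma ratf_inv_nat k f : recf k f -> (forall v, size v = k -> (0 < f v)%N) ->
  ratf k (fun v => (f v)%:R^-1).
Proof.
move=> hf f0; exists (fun=> 1%N), f; split=> //; first exact: recf_const.
by move=> v sv; split; [exact: f0|rewrite div1r].
Qed.

Lemma ratf_exp2N k f : recf k f -> ratf k (fun v => 2 ^- f v).
Proof.
move=> hf; have h v : size v = k -> (0 < 2 ^ f v)%N by rewrite expn_gt0.
by apply: eq_ratf (ratf_inv_nat (recf_expn (recf_const k 2) hf) h) => v _; rewrite natrX.
Qed.

Lemma ratf_ge0 k r v : ratf k r -> size v = k -> 0 <= r v.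
Proof. by move=> [a [b [_ _ h]]] /h [_ ->]; rewrite divr_ge0. Qed.

Lemma ratf_add k r t : ratf k r -> ratf k t -> ratf k (fun v => r v + t v).
Proof.
move=> [a [b [ha hb hr]]] [c [d [hc hd ht]]].
exists (fun v => a v * d v + c v * b v)%N, (fun v => b v * d v)%N; split.
- by apply: recf_addn; exact: recf_muln.
- exact: recf_muln.
move=> v sv; have [b0 ->] := hr v sv; have [d0 ->] := ht v sv.
rewrite muln_gt0 b0 d0; split=> //; rewrite natrD !natrM.
by field; rewrite !pnatr_eq0 -!lt0n b0 d0.
Qed.

Lemma ratf_mul k r t : ratf k r -> ratf k t -> ratf k (fun v => r v * t v).
Proof.
move=> [a [b [ha hb hr]]] [c [d [hc hd ht]]].
exists (fun v => a v * c v)%N, (fun v => b v * d v)%N; split.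
- exact: recf_muln.
- exact: recf_muln.
move=> v sv; have [b0 ->] := hr v sv; have [d0 ->] := ht v sv.
rewrite muln_gt0 b0 d0; split=> //; rewrite !natrM.
by field; rewrite !pnatr_eq0 -!lt0n b0 d0.
Qed.

Lemma ratf_inv k r : (forall v, size v = k -> 0 < r v) -> ratf k r ->
  ratf k (fun v => (r v)^-1).
Proof.
move=> r0 [a [b [ha hb hr]]]; exists b, a; split=> // v sv.
have [b0 rE] := hr v sv; split; last by rewrite rE invf_div.
by rewrite lt0n; apply/eqP => a0; have := r0 v sv; rewrite rE a0 mul0r ltxx.
Qed.

(** Over the common denominator, truncated subtraction of the numerators is exactly the maximum with
    0. *)
Lemma ratf_sub_trunc k r t : ratf k r -> ratf k t ->
  ratf k (fun v => Num.max 0 (r v - t v)).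
Proof.
move=> [a [b [ha hb hr]]] [c [d [hc hd ht]]].
exists (fun v => a v * d v - c v * b v)%N, (fun v => b v * d v)%N; split.
- by apply: recf_subn; exact: recf_muln.
- exact: recf_muln.
move=> v sv; have [b0 ->] := hr v sv; have [d0 ->] := ht v sv.
rewrite muln_gt0 b0 d0; split=> //.
have b1 : (b v)%:R != 0 :> RR by rewrite pnatr_eq0 -lt0n.
have d1 : (d v)%:R != 0 :> RR by rewrite pnatr_eq0 -lt0n.
have -> : (a v)%:R / (b v)%:R - (c v)%:R / (d v)%:R =
    ((a v * d v)%:R - (c v * b v)%:R) / (b v * d v)%:R :> RR.
  by rewrite !natrM; field; rewrite b1 d1.
case: (leqP (c v * b v) (a v * d v)) => h.
  rewrite natrB//; apply/max_idPr; apply: divr_ge0 => //.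
  by rewrite subr_ge0 ler_nat.
rewrite (eqP (ltnW h : _ - _ == 0)%N) mul0r; apply/max_idPl.
by apply: mulr_le0_ge0; rewrite ?invr_ge0// subr_le0 ler_nat ltnW.
Qed.

(** The product of all denominators is a common denominator, and the numerator follows the recursion
    N/B + a/b = (N b + a B)/(B b). *)
Lemma ratf_sum k r m : ratf k.+1 r -> recf k m ->
  ratf k (fun v => \sum_(j < m v) r ((j : nat) :: v)).
Proof.
move=> [a [b [ha hb hr]]] hm.
pose B n v := (\prod_(i < n) b ((i : nat) :: v))%N.
pose N := fun n v => iteri n (fun i y => (y * b (i :: v) + a (i :: v) * B i v)%N) 0%N.
exists (fun v => N (m v) v), (fun v => B (m v) v); split.
- apply: (recf_rec (F := N) (recf_const k 0) _ hm) => [|//|n v sv].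
    have h0 := recf_nth (isT : 0 < k.+2)%N.
    have hB := recf_prod (@recf_cons k 3 _ _ hb (recf_nth (isT : 0 < k.+3)%N)) h0.
    exact: recf_addn (recf_muln (recf_nth (isT : 1 < k.+2)%N) (@recf_cons k 2 _ _ hb h0))
                     (recf_muln (@recf_cons k 2 _ _ ha h0) hB).
  by rewrite /= !drop0.
- exact: recf_prod.
move=> v sv; have b0 i : (0 < b (i :: v))%N by case: (hr (i :: v)) => //=; rewrite sv.
have B0 n : (0 < B n v)%N by apply: prodn_gt0 => i.
split=> //; elim: (m v) => [|n ih]; first by rewrite big_ord0 /N mul0r.
rewrite big_ord_recr /= ih; have [_ ->] : _ := hr (n :: v) (congr1 S sv).
have -> : B n.+1 v = (B n v * b (n :: v))%N by rewrite /B big_ord_recr.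
rewrite /N /= -/(N n v) natrD !natrM.
by field; rewrite !pnatr_eq0 -!lt0n b0 B0.
Qed.

(* With [K = (e v).+1], [t v] is the integer part of [K * log2 (r v)]: the [t]
   with 2^t <= (a/b)^K < 2^(t+1). *)
Lemma ratf_log2 k r e : ratf k r -> recf k e ->
  (forall v, size v = k -> 1 <= r v) ->
  exists q, ratf k q /\ forall v, size v = k ->
    q v <= log2 (r v) <= q v + (e v).+1%:R^-1.
Proof.
move=> [a [b [ha hb hr]]] he r1; set K := fun v => (e v).+1.
pose t v := trunc_log 2 (a v ^ K v %/ b v ^ K v).
have hK : recf k K by exact: recf_succ.
(* [trunc_log] brackets only positive arguments; [1 <= r v] keeps the quotient positive. *)
have X0 v : size v = k -> (0 < a v ^ K v %/ b v ^ K v)%N.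
  move=> sv; have [b0 rE] := hr v sv; rewrite divn_gt0 ?expn_gt0 ?b0//.
  rewrite leq_exp2r//; have := r1 v sv.
  by rewrite rE ler_pdivlMr ?ltr0n// mul1r ler_nat.
have tP v : size v = k ->
    (2 ^ t v * b v ^ K v <= a v ^ K v < 2 ^ (t v).+1 * b v ^ K v)%N.
  move=> sv; have [b0 _] := hr v sv.
  have /andP[] : (2 ^ t v <= a v ^ K v %/ b v ^ K v < 2 ^ (t v).+1)%N.
    exact: trunc_log_bounds (X0 v sv).
  by rewrite leq_divRL ?ltn_divLR ?expn_gt0 ?b0// => -> ->.
(* By the bracketing, [t v] is the least i with a^K < 2^(i+1) b^K, which an unbounded search
   finds. *)
have ht : recf k t.
  apply: (recf_mu (p := (fun i v => a v ^ K v < 2 ^ i.+1 * b v ^ K v)%N)).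
  - apply: recf_negb; apply: recf_leq.
      apply: recf_succ.
      have := recf_expn (recf_drop 1 ha) (recf_drop 1 hK).
      by apply: eq_recf => v _; rewrite drop1.
    have := recf_muln (recf_expn (recf_const _ 2) (recf_succ (recf_nth (isT : 0 < k.+1)%N)))
       (recf_expn (recf_drop 1 hb) (recf_drop 1 hK)).
    by apply: eq_recf => v _; rewrite drop1.
  - by move=> v sv; case/andP: (tP v sv).
  - move=> v i sv it; rewrite -leqNgt; case/andP: (tP v sv) => + _.
    by apply: leq_trans; rewrite leq_mul2r leq_exp2l// it orbT.
exists (fun v => (t v)%:R / (K v)%:R); split.
  by apply: ratf_mul (ratf_nat ht) (ratf_inv_nat hK _).
move=> v sv; have [b0 rE] := hr v sv; have r0 : 0 < r v by exact: lt_le_trans (r1 v sv).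
have ln2 : 0 < ln 2 :> RR by rewrite ln_gt0// ltr1n.
have K0 : 0 < (K v)%:R :> RR by rewrite ltr0n.
have bK : 0 < (b v ^ K v)%:R :> RR by rewrite ltr0n expn_gt0 b0.
have rX : r v ^+ K v = (a v ^ K v)%:R / (b v ^ K v)%:R.
  by rewrite rE expr_div_n !natrX.
have lnX m : ln ((2 ^ m)%:R) = m%:R * ln 2 :> RR.
  by rewrite natrX lnXn ?ltr0n// mulr_natl.
have lnr : ln (r v ^+ K v) = (K v)%:R * ln (r v) by rewrite lnXn// mulr_natl.
have rX0 : 0 < r v ^+ K v by rewrite exprn_gt0.
case/andP: (tP v sv) => lo up.
apply/andP; split; rewrite /log2.
  rewrite ler_pdivrMr// mulrAC ler_pdivlMr// mulrC -[leRHS]mulrC -lnr mulrC -lnX.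
  by rewrite ler_ln ?posrE ?ltr0n ?expn_gt0// rX ler_pdivlMr// -natrM ler_nat.
have -> : (t v)%:R / (K v)%:R + (e v).+1%:R^-1 = (t v).+1%:R / (K v)%:R :> RR.
  by rewrite -[(t v).+1%:R]natr1 mulrDl mul1r.
rewrite ler_pdivlMr// mulrAC ler_pdivrMr// mulrC -lnr -lnX.
rewrite ler_ln ?posrE ?ltr0n ?expn_gt0// rX ler_pdivrMr// -natrM ler_nat.
exact: ltnW.
Qed.

(** The value is at most 0 when the sign exponent is odd, so the numerator is multiplied by
    [~~ odd (s v)]. *)
Lemma ratf_max0 k (r : seq nat -> RR) a b s :
  recf k a -> recf k b -> recf k s ->
  (forall v, size v = k -> b v <> 0%N /\
     r v = (-1) ^+ (s v) * (a v)%:R / (b v)%:R) ->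
  ratf k (fun v => Num.max 0 (r v)).
Proof.
move=> ha hb hs hr; exists (fun v => (~~ odd (s v)) * a v)%N, b; split=> //.
  by apply: recf_muln ha; apply: recf_negb; exact: recf_odd.
move=> v sv; have [/eqP b0 ->] := hr v sv; split; first by rewrite lt0n.
rewrite -signr_odd; case: (odd _) => /=.
  rewrite mul0n mul0r expr1 mulN1r mulNr; apply/max_idPl.
  by rewrite oppr_le0 divr_ge0.
by rewrite mul1n expr0 mul1r; apply/max_idPr; rewrite divr_ge0.
Qed.

(** Clipping at 0 never moves an approximation away from a nonnegative number; this brings signed
    approximations into [ratf]. *)
Lemma max0_approx (x y e : RR) : 0 <= x -> `|x - y| < e -> `|x - Num.max 0 y| < e.
Proof.
rewrite !ltr_norml => x0 /andP[xy yx]; rewrite /Num.max.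
by case: (ltP 0 y) => y0; apply/andP; split; lra.
Qed.

(** The clipped approximation has error below 2^-n, so shifting it by 2^-n down or up gives a bound
    on either side; error and shift add up to 2 * 2^-n. *)
Lemma computable_real_bounds x : 0 <= x -> computable_real x ->
  exists lo up, [/\ ratf 1 (fun v => lo (nth 0%N v 0)),
    ratf 1 (fun v => up (nth 0%N v 0)) &
    forall n, [/\ 0 <= lo n, lo n <= x, x <= up n, x <= lo n + 2 * 2 ^- n
                & up n <= x + 2 * 2 ^- n]].
Proof.
move=> x0 [r [[a [b [s [[ca ha] [cb hb] [cs hs] hr]]]] xr]].
pose t n := Num.max 0 (r n).
have ht : ratf 1 (fun v => t (nth 0%N v 0)).
  apply: (ratf_max0 (a := fun v => a (nth 0%N v 0)) (b := fun v => b (nth 0%N v 0))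
    (s := fun v => s (nth 0%N v 0))).
  - by exists ca => -[|n []].
  - by exists cb => -[|n []].
  - by exists cs => -[|n []].
  - by move=> v _; exact: hr.
have h2 := ratf_exp2N (recf_nth (isT : 0 < 1)%N).
exists (fun n => Num.max 0 (t n - 2 ^- n)), (fun n => t n + 2 ^- n); split.
- exact: ratf_sub_trunc ht h2.
- exact: ratf_add ht h2.
move=> n; have := max0_approx x0 (xr n); rewrite -/(t n) ltr_norml.
move: (2 ^- n) (t n) => e y /andP[h1 h3].
by rewrite /Num.max; case: (ltP 0 (y - e)) => ye; split; lra.
Qed.

(** [Sigma1] with nonnegative terms, in the list form for which [ratf] has closure lemmas. *)
Definition lower_real (x : RR) : Prop :=
  exists r : nat -> RR, [/\ ratf 1 (fun v => r (nth 0%N v 0)),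
    (forall n, r n <= r n.+1) & r @ \oo --> x].

Lemma Sigma1_lower_real x : lower_real x -> Sigma1 x.
Proof.
move=> [r [[a [b [ha hb hr]]] rle rx]]; exists r; split=> //.
exists (fun n => a [:: n]), (fun n => b [:: n]), (fun=> 0%N); split.
- exact: recf_recursive1.
- exact: recf_recursive1.
- exact: recf_recursive1 (recf_const 1 0).
move=> n; have [b0 /= ->] := hr [:: n] erefl.
by rewrite expr0 mul1r; split=> //; apply/eqP; rewrite -lt0n.
Qed.

Lemma lower_realD x y : lower_real x -> lower_real y -> lower_real (x + y).
Proof.
move=> [r [hr rle rx]] [t [ht tle ty]]; exists (fun n => r n + t n); split.
- exact: ratf_add hr ht.
- by move=> n; rewrite lerD.
- exact: (@cvgD RR RR^o _ \oo _ r t x y rx ty).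
Qed.

(* The running maximum of [L] is [L] at a running argmax, and comparing two
   rational values of [L] is a comparison of natural numbers. *)
Lemma lower_real_sup (L : nat -> RR) x : ratf 1 (fun v => L (nth 0%N v 0)) ->
  (forall n, L n <= x) -> L @ \oo --> x -> lower_real x.
Proof.
move=> [a [b [/recf_recursive1 ha /recf_recursive1 hb hL]]] Lx Lcvg.
pose c n m := (a [:: n] * b [:: m] < a [:: m] * b [:: n])%N.
have b0 n : (0 < b [:: n])%N by case: (hL [:: n] erefl).
have LE n : L n = (a [:: n])%:R / (b [:: n])%:R by case: (hL [:: n] erefl).
have cE n m : c n m = (L n < L m).
  rewrite !LE ltr_pdivrMr ?ltr0n// mulrAC ltr_pdivlMr ?ltr0n//.
  by rewrite -!natrM ltr_nat.
pose M := fun n (v : seq nat) => iteri n (fun i y => if c y i.+1 then i.+1 else y) 0%N.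
have hM : recf 1 (fun v => M (nth 0%N v 0) v).
  apply: (recf_rec (F := M) (recf_const 1 0) _ (recf_nth (isT : 0 < 1)%N)
    (g := fun w => if c (nth 0%N w 1) (nth 0%N w 0).+1 then (nth 0%N w 0).+1
                   else nth 0%N w 1)) => //.
  have h0 := recf_succ (recf_nth (isT : 0 < 3)%N).
  have h1 := recf_nth (isT : 1 < 3)%N.
  apply: recf_if (h0) (h1); apply: recf_leq.
    exact: recf_succ (recf_muln (recf_app1 ha h1) (recf_app1 hb h0)).
  exact: recf_muln (recf_app1 ha h0) (recf_app1 hb h1).
pose m n := M n [::].
have mle n i : (i <= n)%N -> L i <= L (m n).
  elim: n => [|n ih]; first by rewrite leqn0 => /eqP ->.
  have -> : m n.+1 = if c (m n) n.+1 then n.+1 else m n by [].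
  rewrite cE leq_eqVlt ltnS => /orP[/eqP ->|/ih]; case: ltP => //.
  by move=> h /le_trans; apply; exact: ltW.
exists (fun n => L (m n)); split.
- exists (fun v => a [:: m (nth 0%N v 0)]), (fun v => b [:: m (nth 0%N v 0)]).
  split; [exact: recf_app1 ha hM | exact: recf_app1 hb hM |].
  by move=> v _; rewrite -LE.
- move=> n; have -> : m n.+1 = if c (m n) n.+1 then n.+1 else m n by [].
  by rewrite cE; case: ltP => // /ltW.
(* The running maximum lies between [L] and the constant [x]. *)
- apply: (squeeze_cvgr (f := L) (h := cst x)) => //; last exact: cvg_cst.
  by apply: nearW => n /=; rewrite mle//=.
Qed.

(** * Lower sums on the half-line *)

Section lower_sums.
Variable R : realType.
Local Notation mu := (@lebesgue_measure R).
Implicit Types (D m j n : nat) (x : R).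

Definition cell D j : set R := `[j%:R / D%:R, j.+1%:R / D%:R[.

Definition step D m (psi : nat -> R) x : R :=
  \sum_(j < m) psi j * \1_(cell D j) x.

Lemma measurable_step D m psi : measurable_fun setT (step D m psi).
Proof.
apply: measurable_sum => j; apply: measurable_funM => //.
by apply: measurable_indic; exact: measurable_itv.
Qed.

(** Half-open cells tile the half-line, so finding the cell of a point amounts to taking an integer
    part. *)
Lemma cellP D j x : (0 < D)%N -> 0 <= x ->
  reflect (cell D j x) (Num.truncn (x * D%:R) == j).
Proof.
move=> D0 x0; have D0' : 0 < D%:R :> R by rewrite ltr0n.
rewrite truncn_eq ?mulr_ge0//; apply: (iffP idP);
  by rewrite /cell /= in_itv/= ler_pdivrMr// ltr_pdivlMr.
Qed.

Lemma stepE D m psi x : (0 < D)%N -> 0 <= x ->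
  step D m psi x = if (Num.truncn (x * D%:R) < m)%N
                   then psi (Num.truncn (x * D%:R)) else 0.
Proof.
move=> D0 x0; rewrite /step; under eq_bigr => j _.
  rewrite indicE (_ : (x \in cell D j) = (Num.truncn (x * D%:R) == j :> nat)).
    over.
  by apply/idP/idP; rewrite inE => /(cellP _ D0 x0).
case: ltnP => [tm|mt].
  rewrite (bigD1 (Ordinal tm)) //= eqxx mulr1 big1 ?addr0// => i.
  by rewrite -val_eqE /= eq_sym => /negPf ->; rewrite mulr0.
rewrite big1// => i _; rewrite gtn_eqF ?mulr0//.
exact: leq_trans (ltn_ord i) mt.
Qed.

Lemma integral_step D m psi : (0 < D)%N -> (forall j, 0 <= psi j) ->
  (\int[mu]_(x in `[0%R, +oo[) (step D m psi x)%:E =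
   (\sum_(j < m) psi j / D%:R)%:E)%E.
Proof.
move=> D0 psi0; have D0' : 0 < D%:R :> R by rewrite ltr0n.
pose F (j : 'I_m) x := (psi j * \1_(cell D j) x)%:E.
transitivity (\int[mu]_(x in `[0%R, +oo[) (\sum_(j < m) F j x))%E.
  by apply: eq_integral => x _; rewrite sumEFin.
have mcell j : measurable (cell D j) by exact: measurable_itv.
have mI : measurable (`[0%R, +oo[ : set R) by exact: measurable_itv.
rewrite ge0_integral_sum.
- rewrite -sumEFin; apply: eq_bigr => j _.
  (* The side condition of [integralZl_indic] on negative coefficients holds vacuously. *)
  have neg : psi j < 0 -> cell D j = set0 by rewrite ltNge psi0.
  rewrite (@integralZl_indic _ _ R mu _ mI (fun=> cell D j) _ neg (mcell j)).
  have sub : cell D j `<=` `[0%R, +oo[.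
    move=> x; rewrite /cell /= !in_itv/= andbT => /andP[+ _]; apply: le_trans.
    by rewrite divr_ge0.
  have cellE : mu (cell D j) = (D%:R^-1)%:E.
    rewrite [LHS]lebesgue_measure_itv/= lte_fin ltr_pM2r ?invr_gt0// ltr_nat ltnSn.
    by rewrite -EFinB -mulrBl -natrB// subSnn mul1r.
  have := integral_indic mu mI (mcell j); rewrite (setIidl sub) => ->.
  by rewrite [X in (_ * X)%E]cellE -EFinM.
- exact: measurable_itv.
- move=> j; apply/measurable_EFinP; apply: measurable_funM => //.
  by apply: measurable_indic; exact: mcell.
- by move=> j x _; rewrite lee_fin mulr_ge0.
Qed.

(** Dominated convergence applies with [h] itself as the dominating function. The n-th sum takes
    [n * D n] cells of length 1/D n, so it covers [0, n). *)
Lemma lower_sum_cvg (h : R -> R) (D : nat -> nat) (psi : nat -> nat -> R) :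
  (forall n, 0 < D n)%N -> (forall n j, 0 <= psi n j) ->
  continuous h ->
  (\int[mu]_(x in `[0%R, +oo[) (h x)%:E < +oo)%E ->
  (forall n j x, cell (D n) j x -> psi n j <= h x) ->
  (forall x, 0 <= x -> psi n (Num.truncn (x * (D n)%:R)) @[n --> \oo] --> h x) ->
  let S n := \sum_(j < n * D n) psi n j / (D n)%:R in
  let I := fine (\int[mu]_(x in `[0%R, +oo[) (h x)%:E) in
  (forall n, S n <= I) /\ S @ \oo --> I.
Proof.
move=> D0 psi0 ch hoo psih psicvg S I.
have mh : measurable_fun setT h by exact: continuous_measurable_fun.
pose s n := step (D n) (n * D n) (psi n).
(* Every such point lies in a cell, where [h] is bounded below by a nonnegative value of [psi]. *)
have h0 x : 0 <= x -> 0 <= h x.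
  move=> x0; apply: le_trans (psih 0%N (Num.truncn (x * (D 0%N)%:R)) x _) => //.
  exact/cellP.
have mI : measurable (`[0%R, +oo[ : set R) by exact: measurable_itv.
have inI (x : R) : `[0%R, +oo[%classic x -> 0 <= x by rewrite /= in_itv/= andbT.
have mhE : measurable_fun (`[0%R, +oo[ : set R) (EFin \o h).
  by apply/measurable_EFinP; exact: measurable_funTS.
have IE : (\int[mu]_(x in `[0%R, +oo[) (h x)%:E = I%:E)%E.
  rewrite fineK// ge0_fin_numE//; apply: integral_ge0 => x /inI x0.
  by rewrite lee_fin h0.
have SE n : (\int[mu]_(x in `[0%R, +oo[) (s n x)%:E = (S n)%:E)%E.
  by rewrite integral_step.
have s0 n x : 0 <= x -> 0 <= s n x.
  by move=> x0; rewrite /s stepE//; case: ifP.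
have sh n x : 0 <= x -> s n x <= h x.
  move=> x0; rewrite /s stepE//; case: ifP => _; last exact: h0.
  by apply: psih; exact/cellP.
have ms n : measurable_fun (`[0%R, +oo[ : set R) (fun x => (s n x)%:E).
  by apply/measurable_EFinP; apply: measurable_funTS; exact: measurable_step.
split.
  move=> n; rewrite -lee_fin -IE -SE; apply: ge0_le_integral => //.
  - by move=> x /inI x0; rewrite lee_fin s0.
  - exact: ms.
  - by move=> x /inI x0; rewrite lee_fin sh.
(* Once n exceeds x, the cell of x is among the first [n * D n], and the step function takes the
   value of [psi] there. *)
have scvg x : 0 <= x -> s n x @[n --> \oo] --> h x.
  move=> x0; apply: cvg_trans (psicvg x x0); apply: near_eq_cvg.
  near=> n; rewrite /s stepE// ifT//.
  have xn : x < n%:R by near: n; exact: nbhs_infty_gtr.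
  rewrite -(ltr_nat R); apply: le_lt_trans (_ : x * (D n)%:R < _).
    by rewrite truncn_le// mulr_ge0.
  by rewrite natrM ltr_pM2r// ltr0n.
have hI : mu.-integrable (`[0%R, +oo[ : set R) (EFin \o h).
  apply/integrableP; split=> //; apply: le_lt_trans hoo.
  rewrite le_eqVlt; apply/orP; left; apply/eqP; apply: eq_integral => x.
  by rewrite inE => /inI x0 /=; rewrite ger0_norm// h0.
have -> : S = fine \o (fun n => \int[mu]_(x in `[0%R, +oo[) (s n x)%:E)%E.
  by apply/funext => n /=; rewrite SE.
apply: fine_cvg; rewrite -IE; have H := @dominated_cvg _ _ R mu _ mI (fun n x => (s n x)%:E) (EFin \o h) (EFin \o h) ms.
apply: H => //.
- by move=> x /inI x0; apply: cvg_EFin; [exact: nearW | exact: scvg].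
- by move=> n x /inI x0; rewrite /= lee_fin ger0_norm ?s0// sh.
Unshelve. all: by end_near. Qed.
End lower_sums.

(** * Limits of real sequences, and splitting an integral at 0 *)

Section real_limits.
Variable R : realType.
Implicit Types (x y : R).

Lemma cvg_exp2N : (fun n => 2 ^- n : R) @ \oo --> (0 : R).
Proof.
under eq_fun do rewrite -exprVn.
by apply: cvg_expr; rewrite ger0_norm// invf_lt1// ltr1n.
Qed.

Lemma cvg_exp2NM (a : R) : (fun n => a * 2 ^- n) @ \oo --> (0 : R).
Proof. by rewrite -(mulr0 a); apply: cvgM; [exact: cvg_cst | exact: cvg_exp2N]. Qed.

Lemma continuous_comp_opp (f : R -> R) : continuous f -> continuous (fun x => f (- x)).
Proof.
move=> cf x; apply: (@continuous_comp _ _ _ -%R f); last exact: cf.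
exact: opp_continuous.
Qed.

Lemma cvg_of_dist (u e : R^nat) x :
  (forall n, `|x - u n| <= e n) -> e @ \oo --> (0 : R) -> u @ \oo --> x.
Proof.
move=> ue e0; apply/cvgrPdist_le => eps eps0.
move/cvgrPdist_le : e0 => /(_ _ eps0); apply: filterS => n.
by rewrite sub0r normrN => /(le_trans (ler_norm _)); exact: le_trans.
Qed.

(** The filter is arbitrary so that the lemma serves both sequences and continuity at a point, where
    [c] is constant and [t] the identity. *)
Lemma cvg_log_quad (T : Type) (F : set_system T) {FF : Filter F} (c t : T -> R) (Q x : R) :
  0 <= Q -> c @ F --> Q -> t @ F --> x ->
  ln (1 + c n * t n ^+ 2) / ln 2 @[n --> F] --> ln (1 + Q * x ^+ 2) / ln 2.
Proof.
move=> Q0 cQ tx; apply: cvgM; last exact: cvg_cst.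
apply: (@continuous_cvg _ _ _ F _ (fun n => 1 + c n * t n ^+ 2) (@ln R)).
  by apply: continuous_ln; rewrite ltr_pwDl// mulr_ge0// sqr_ge0.
apply: cvgD; first exact: cvg_cst.
apply: cvgM => //.
by apply: (@continuous_cvg _ _ _ F _ t (fun z : R => z ^+ 2)) => //;
  exact: exprn_continuous.
Qed.

Lemma continuous_log_quad_mul (Q : R) (f : R -> R) : 0 <= Q -> continuous f ->
  continuous (fun x => ln (1 + Q * x ^+ 2) / ln 2 * f x).
Proof.
move=> Q0 cf x; apply: cvgM; last exact: cf.
by apply: cvg_log_quad => //; exact: cvg_cst.
Qed.

Lemma cvg_lower_product (q g c t : R^nat) (Q x y : R) : 0 <= Q ->
  c @ \oo --> Q -> t @ \oo --> x ->
  (forall n, q n <= ln (1 + c n * t n ^+ 2) / ln 2 <= q n + n.+1%:R^-1) ->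
  (forall n, `|y - g n| <= 4 * 2 ^- n) ->
  q n * g n @[n --> \oo] --> ln (1 + Q * x ^+ 2) / ln 2 * y.
Proof.
move=> Q0 cQ tx qP gP; apply: cvgM; last first.
  exact: cvg_of_dist gP (cvg_exp2NM 4).
set l := (fun n => ln (1 + c n * t n ^+ 2) / ln 2).
have lcvg : l @ \oo --> ln (1 + Q * x ^+ 2) / ln 2 by exact: cvg_log_quad.
have -> : q = l \- (l \- q) by apply/funext => n /=; rewrite subKr.
rewrite -[X in _ --> X]subr0; apply: cvgB => //.
apply: (@cvg_of_dist _ (fun n => n.+1%:R^-1)); last exact: cvg_harmonic.
move=> n /=; have /andP[] : q n <= l n <= q n + n.+1%:R^-1 by exact: qP.
move: (n.+1%:R^-1) => e h1 h2; rewrite sub0r normrN ler_norml.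
by apply/andP; split; lra.
Qed.

(** The complement of [0, oo) is open at 0; adding that endpoint does not change the integral, and
    the substitution of -x for x then maps it to [0, oo). *)
Lemma ge0_integralT_split (h : R -> R) : continuous h -> (forall x, 0 <= h x) ->
  (\int[@lebesgue_measure R]_x (h x)%:E =
   \int[@lebesgue_measure R]_(x in `[0%R, +oo[) (h x)%:E +
   \int[@lebesgue_measure R]_(x in `[0%R, +oo[) (h (- x))%:E)%E.
Proof.
move=> ch h0; have mh : measurable_fun [set: R] h by exact: continuous_measurable_fun.
have mpos : measurable (`[0, +oo[%classic : set R) by exact: measurable_itv.
rewrite -(setUv `[0, +oo[%classic) ge0_integral_setU//=; last 4 first.
- exact: measurableC.
- by apply/measurable_EFinP; rewrite setUv.
- by move=> x _; rewrite lee_fin.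
- exact/disj_setPCl.
congr +%E; rewrite setCitvr integral_itv_bndo_bndc; last exact/measurable_EFinP/measurable_funTS.
rewrite -{1}oppr0 ge0_integration_by_substitutionNy//.
exact: continuous_subspaceT.
Qed.

End real_limits.

(** * Secrecy rate integrals *)

(* The grid points j / D n are values of the single computable sequence
   u n / (w n + 1), to which the computability of [f] applies. *)
Lemma grid_value_approx (f : RR -> RR) D : (forall x, 0 <= f x) ->
  computable_continuous f -> recursive1 D -> (forall n, 0 < D n)%N ->
  exists t : nat -> nat -> RR,
    ratf 2 (fun v => t (nth 0%N v 0) (nth 0%N v 1)) /\
    forall j n, `|f (j%:R / (D n)%:R) - t j n| < 2 ^- n.
Proof.
move=> f0 [fseq _] hD D0.
have [u [w [hu hw [p [hp pK]]]]] := recf_unpairing.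
pose x n : RR := (u n)%:R / (w n).+1%:R.
have h0 : recf 2 (fun v => nth 0%N v 0) by exact: recf_nth.
have h1 : recf 2 (fun v => nth 0%N v 1) by exact: recf_nth.
(* Each [x n] is rational and serves as its own approximation at every precision. *)
have cx : computable_seq x.
  exists (fun n _ => x n); split; last by move=> n k; rewrite subrr normr0 invr_gt0 exprn_gt0.
  exists (fun n _ => u n), (fun n _ => (w n).+1), (fun _ _ => 0%N); split.
  - exact: recf_recursive2 (recf_app1 hu h0).
  - exact: recf_recursive2 (recf_succ (recf_app1 hw h0)).
  - exact: recf_recursive2 (recf_const 2 0).
  - by move=> n k; rewrite expr0 mul1r.
have [r [[a [b [s [ha hb hs hr]]]] fr]] := fseq x cx.
(* The sequence [x] adds 1 to the decoded denominator, hence the predecessor of the positive number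
   [D n]. *)
pose i j n := p j (D n).-1.
have hi : recf 2 (fun v => i (nth 0%N v 0) (nth 0%N v 1)).
  exact: recf_app2 hp h0 (recf_pred (recf_app1 hD h1)).
exists (fun j n => Num.max 0 (r (i j n) n)); split.
  apply: (ratf_max0 (recf_app2 ha hi h1) (recf_app2 hb hi h1) (recf_app2 hs hi h1)).
  by move=> v _; exact: hr.
move=> j n; apply: max0_approx => //.
have -> : j%:R / (D n)%:R = x (i j n).
  by rewrite /x; have [-> ->] := pK j (D n).-1; rewrite prednK.
exact: fr.
Qed.

Lemma lower_real_half_line (f : RR -> RR) (Q : RR) (c : nat -> RR) :
  (forall x, 0 <= f x) -> continuous f -> computable_continuous f ->
  0 <= Q -> ratf 1 (fun v => c (nth 0%N v 0)) -> (forall n, c n <= Q) ->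
  c @ \oo --> Q ->
  (\int[@lebesgue_measure RR]_(x in `[0%R, +oo[)
     (log2 (1 + Q * x ^+ 2) * f x)%:E < +oo)%E ->
  lower_real (fine (\int[@lebesgue_measure RR]_(x in `[0%R, +oo[)
     (log2 (1 + Q * x ^+ 2) * f x)%:E)%E).
Proof.
move=> f0 cf ccf Q0 hc cQ ccvg hoo.
have [d [hd d0 df]] := ccf.2.
(* The factor [d n] makes cells short enough for the modulus of [f]; the factor [n.+1] makes their
   left endpoints converge to any point they contain. *)
pose D n := (d n * n.+1)%N.
have D0 n : (0 < D n)%N by rewrite muln_gt0 d0.
have hD : recursive1 D.
  have h := recf_nth (isT : 0 < 1)%N.
  exact: recf_recursive1 (recf_muln (recf_app1 hd h) (recf_succ h)).
have [t [ht ft]] := grid_value_approx f0 ccf hD D0.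
have h0 : recf 2 (fun v => nth 0%N v 0) by exact: recf_nth.
have h1 : recf 2 (fun v => nth 0%N v 1) by exact: recf_nth.
have hD1 : ratf 2 (fun v => (D (nth 0%N v 1))%:R^-1).
  exact: ratf_inv_nat (recf_app1 hD h1) _.
have c0 n : 0 <= c n by exact: (ratf_ge0 (v := [:: n]) hc erefl).
(* The approximation error and the oscillation of [f] on a cell are both at most
   2^-n. *)
pose g j n := Num.max 0 (t j n - 2 * 2 ^- n).
have hg : ratf 2 (fun v => g (nth 0%N v 0) (nth 0%N v 1)).
  exact: ratf_sub_trunc ht (ratf_mul (ratf_nat (recf_const 2 2)) (ratf_exp2N h1)).
pose T j n : RR := j%:R / (D n)%:R.
have hT : ratf 2 (fun v => T (nth 0%N v 0) (nth 0%N v 1)).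
  exact: ratf_mul (ratf_nat h0) hD1.
have hc1 : ratf 2 (fun v => c (nth 0%N v 1)).
  have [a [b [/recf_recursive1 ha /recf_recursive1 hb hab]]] := hc.
  exists (fun v => a [:: nth 0%N v 1]), (fun v => b [:: nth 0%N v 1]).
  split; [exact: recf_app1 ha h1 | exact: recf_app1 hb h1 |].
  by move=> v _; exact: hab [:: nth 0%N v 1] erefl.
have hr : ratf 2 (fun v => 1 + c (nth 0%N v 1) * T (nth 0%N v 0) (nth 0%N v 1) ^+ 2).
  exact: ratf_add (ratf_nat (recf_const 2 1)) (ratf_mul hc1 (ratf_mul hT hT)).
have [|q [hq qP]] := ratf_log2 hr h1.
  by move=> v _; rewrite lerDl mulr_ge0// sqr_ge0.
pose psi n j := q [:: j; n] * g j n.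
have near_cell n j x : @cell RR (D n) j x ->
    [/\ 0 <= T j n, T j n <= x, `|x - T j n| <= (d n)%:R^-1 &
        `|x - T j n| <= n.+1%:R^-1].
  have D0' : 0 < (D n)%:R :> RR by rewrite ltr0n.
  rewrite /cell /= in_itv/= -/(T j n) => /andP[Tx xT].
  have xTD : `|x - T j n| <= (D n)%:R^-1.
    rewrite ger0_norm ?subr_ge0// lerBlDl; apply: le_trans (ltW xT) _.
    by rewrite /T -natr1 mulrDl mul1r.
  split=> //; first by rewrite divr_ge0.
    apply: le_trans xTD _; rewrite lef_pV2 ?posrE ?ltr0n// ler_nat.
    by rewrite leq_pmulr.
  apply: le_trans xTD _; rewrite lef_pV2 ?posrE ?ltr0n// ler_nat.
  by rewrite leq_pmull.
(* [t j n] is within 2 * 2^-n of [f x]; subtracting that amount yields a lower bound and doubles the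
   possible gap. *)
have gP n j x : @cell RR (D n) j x -> g j n <= f x <= g j n + 4 * 2 ^- n.
  move=> /near_cell[_ _ /df + _]; have := ft j n; rewrite -/(T j n).
  rewrite /g ltr_norml ler_norml; have := f0 x.
  move: (2 ^- n) (t j n) (f x) (f (T j n)) => e y z z' z0 /andP[? ?] /andP[? ?].
  by rewrite /Num.max; case: (ltP 0 (y - 2 * e)) => ye; apply/andP; split; lra.
have q0 n j : 0 <= q [:: j; n] by exact: ratf_ge0 hq _.
have g0 n j : 0 <= g j n by rewrite le_max lexx.
have qle n j : q [:: j; n] <= log2 (1 + c n * T j n ^+ 2) <=
    q [:: j; n] + n.+1%:R^-1.
  exact: qP [:: j; n] erefl.
have ln2 : 0 < ln 2 :> RR by rewrite ln_gt0// ltr1n.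
have psile n j x : @cell RR (D n) j x -> psi n j <= log2 (1 + Q * x ^+ 2) * f x.
  move=> cx; have /andP[gf _] := gP _ _ _ cx; have [T0 Tx _ _] := near_cell _ _ _ cx.
  have x0 : 0 <= x by exact: le_trans Tx.
  have sqp (y z : RR) : 0 <= y -> 0 < 1 + y * z ^+ 2.
    by move=> y0; rewrite ltr_pwDl// mulr_ge0// sqr_ge0.
  (* The factors are nonnegative, and the logarithm increases when [c n] is raised to [Q] and
     [T j n] to [x]. *)
  apply: ler_pM => //; case/andP: (qle n j) => /le_trans + _; apply.
  rewrite /log2 ler_pM2r ?invr_gt0// ler_ln ?posrE ?sqp// lerD2l.
  by apply: ler_pM => //; [exact: sqr_ge0 | rewrite ler_sqr ?nnegrE].
have psicvg x : 0 <= x ->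
    psi n (Num.truncn (x * (D n)%:R)) @[n --> \oo] --> log2 (1 + Q * x ^+ 2) * f x.
  move=> x0; pose j n := Num.truncn (x * (D n)%:R).
  have cx n : @cell RR (D n) (j n) x by exact/cellP.
  have gd n : `|f x - g (j n) n| <= 4 * 2 ^- n.
    have /andP[gf fg] := gP _ _ _ (cx n).
    by rewrite ger0_norm ?subr_ge0// lerBlDl.
  apply: (@cvg_lower_product RR (fun n => q [:: j n; n]) (fun n => g (j n) n) c
    (fun n => T (j n) n)) => //.
  apply: (@cvg_of_dist RR _ (fun n => n.+1%:R^-1)); last exact: cvg_harmonic.
  by move=> n; case: (near_cell _ _ _ (cx n)).
have ch : continuous (fun x : RR => log2 (1 + Q * x ^+ 2) * f x).
  exact: continuous_log_quad_mul.
have psi0 n j : 0 <= psi n j by rewrite mulr_ge0.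
have [SI Scvg] := lower_sum_cvg D0 psi0 ch hoo psile psicvg.
apply: lower_real_sup SI Scvg.
(* [ratf_sum] puts the summation index at the head of the list, so entry 0 is the cell index j and
   entry 1 is n. *)
apply: (ratf_sum (r := fun v => psi (nth 0%N v 1) (nth 0%N v 0) / (D (nth 0%N v 1))%:R)
  (m := fun v => (nth 0 v 0 * D (nth 0 v 0))%N)).
  apply: ratf_mul hD1; apply: ratf_mul hg.
  by apply: eq_ratf hq => -[|j [|n []]].
have h := recf_nth (isT : 0 < 1)%N.
exact: recf_muln h (recf_app1 hD h).
Qed.

(** Lower bounds of [P] are divided by upper bounds of [s]; the latter are at least [s], hence
    positive for every n. *)
Lemma lower_approx_div (P s : RR) : computable_real P -> 0 < P ->
  computable_real s -> 0 < s -> exists c : nat -> RR,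
  [/\ ratf 1 (fun v => c (nth 0%N v 0)), forall n, c n <= P / s & c @ \oo --> P / s].
Proof.
move=> cP P0 cs s0.
have [lo [lo_up [hlo _ loP]]] := computable_real_bounds (ltW P0) cP.
have [up_lo [up [_ hup upP]]] := computable_real_bounds (ltW s0) cs.
have up0 n : 0 < up n by have [_ _ h _ _] := upP n; exact: lt_le_trans h.
exists (fun n => lo n / up n); split.
- by apply: ratf_mul hlo _; exact: ratf_inv hup.
- move=> n; have [l0 lP _ _ _] := loP n; have [_ _ su _ _] := upP n.
  apply: ler_pM => //; first by rewrite invr_ge0 ltW.
  by rewrite lef_pV2 ?posrE.
have e0 : (fun n => 2 * 2 ^- n : RR) @ \oo --> (0 : RR).
  exact: cvg_exp2NM.
have cvlo : lo @ \oo --> P.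
  apply: (@cvg_of_dist RR lo _ P _ e0) => n; have [_ lP _ Pl _] := loP n.
  by rewrite ger0_norm ?subr_ge0// lerBlDl.
have cvup : up @ \oo --> s.
  apply: (@cvg_of_dist RR up _ s _ e0) => n; have [_ _ su _ us] := upP n.
  by rewrite distrC ger0_norm ?subr_ge0// lerBlDl.
apply: (@cvgM RR _ \oo) => //.
by apply: (@cvgV RR _ \oo) => //; rewrite gt_eqF.
Qed.

(** Negating a computable sequence adds 1 to its sign exponents, and reflection preserves distances,
    so the same modulus works. *)
Lemma computable_continuous_opp f :
  computable_continuous f -> computable_continuous (fun x => f (- x)).
Proof.
move=> [fseq [d [hd d0 fd]]]; split; last first.
  by exists d; split=> // N x y xy; apply: fd; rewrite -opprD normrN.
move=> x [r [[a [b [s [ha hb hs hr]]]] xr]].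
apply: (fseq (fun n => - x n)); exists (fun n k => - r n k); split; last first.
  by move=> n k; rewrite -opprD normrN.
have h0 : recf 2 (fun v => nth 0%N v 0) by exact: recf_nth.
have h1 : recf 2 (fun v => nth 0%N v 1) by exact: recf_nth.
exists a, b, (fun n k => (s n k).+1); split=> //.
  exact: recf_recursive2 (recf_succ (recf_app2 hs h0 h1)).
move=> n k; have [b0 ->] := hr n k; split=> //.
by rewrite exprS mulN1r !mulNr.
Qed.

Lemma lower_real_rate (f : RR -> RR) (P s : RR) :
  (forall x, 0 <= f x) -> continuous f -> computable_continuous f ->
  (integral_R (rate_integrand P s f) < +oo)%E ->
  computable_real P -> 0 < P -> computable_real s -> 0 < s ->
  lower_real (fine (integral_R (rate_integrand P s f))).
Proof.
move=> f0 cf ccf foo cP P0 cs s0.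
have [c [hc cle ccvg]] := lower_approx_div cP P0 cs s0.
have Q0 : 0 <= P / s by rewrite divr_ge0 ?ltW.
pose h (g : RR -> RR) x := log2 (1 + P / s * x ^+ 2) * g x.
have hE : rate_integrand P s f = h f.
  by apply/funext => x; rewrite /rate_integrand /h (mulrAC P).
have ch : continuous (h f) by exact: continuous_log_quad_mul.
have ln2 : 0 < ln 2 :> RR by rewrite ln_gt0// ltr1n.
have hge0 (g : RR -> RR) x : (forall y, 0 <= g y) -> 0 <= h g x.
  move=> g0; rewrite mulr_ge0// /log2 divr_ge0 ?(ltW ln2)// ln_ge0//.
  by rewrite lerDl mulr_ge0// sqr_ge0.
pose I g := (\int[@lebesgue_measure RR]_(x in `[0%R, +oo[) (h g x)%:E)%E.
have fN0 x : 0 <= f (- x) by [].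
have I0 g : (forall y, 0 <= g y) -> (0 <= I g)%E.
  by move=> g0; apply: integral_ge0 => x _; rewrite lee_fin hge0.
(* The logarithmic factor is even, so reflection changes only the density. *)
have split_eq : integral_R (rate_integrand P s f) = (I f + I (fun x => f (- x)%R))%E.
  rewrite hE /integral_R (ge0_integralT_split ch); last by move=> x; exact: hge0.
  by congr (_ + _)%E; apply: eq_integral => x _; rewrite /h sqrrN.
rewrite split_eq in foo *.
have If : (I f < +oo)%E by apply: le_lt_trans foo; rewrite leeDl// I0.
have IN : (I (fun x => f (- x)%R) < +oo)%E by apply: le_lt_trans foo; rewrite leeDr// I0.
rewrite fineD ?ge0_fin_numE ?I0//; apply: lower_realD.
  exact: lower_real_half_line ccvg If.
apply: lower_real_half_line ccvg IN => //.
  exact: continuous_comp_opp.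
exact: computable_continuous_opp.
Qed.

(* s1, s2 stand for sigma_1^2, sigma_2^2 *)
Theorem theorem3 (f1 f2 : RR -> RR) (P s1 s2 : RR) :
  pdf f1 -> pdf f2 ->
  continuous f1 -> continuous f2 ->
  computable_continuous f1 -> computable_continuous f2 ->
  computable_L1 f1 -> computable_L1 f2 ->
  (integral_R (rate_integrand P s1 f1) < +oo)%E ->
  (integral_R (rate_integrand P s2 f2) < +oo)%E ->
  computable_real P -> 0 < P ->
  computable_real s1 -> 0 < s1 ->
  computable_real s2 -> 0 < s2 ->
  Delta2 (CS P f1 f2 s1 s2).
Proof.
move=> [f10 _] [f20 _] c1 c2 cc1 cc2 _ _ fin1 fin2 cP P0 cs1 s10 cs2 s20.
exists (fine (integral_R (rate_integrand P s1 f1))),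
  (fine (integral_R (rate_integrand P s2 f2))).
by split=> //; apply: Sigma1_lower_real; exact: lower_real_rate.
Qed.
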